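(* Let $F$ be a field and $P\in F[t]$ a polynomial of degree $d\ge 1$. Let $z\in\hat K^{\times}$, let $\{(n_i,f_i)\}_{i=1}^{N}$ be the sequence defining its generalized Schneider continued fraction, and let $x_r(z)$ be its convergents. Then for every integer $r$ with $0\le r<N$ there exist $p_r,q_r\in A[\frac1P]$ such that $x_r(z)=\frac{p_r}{q_r}$ and $$\nu\left(z-\frac{p_r}{q_r}\right)=-2\nu(q_r)+\deg(f_{r+1})-\sum_{i=1}^{r+1}n_id,$$ or, in other words, $$\left|z-\frac{p_r}{q_r}\right|=\frac{\left|P^{\sum_{i=1}^{r+1}n_i}\right|}{|f_{r+1}|\,|q_r|^2}.$$
   Context: Notation: $A=F[t]$, $K=F(t)$, $\hat K=F(\!(t^{-1})\!)$ is the completion of $K$ with respect to the valuation $\nu$ given by $\nu(f/g)=\deg(g)-\deg(f)$ (extended to $\hat K$). $|\cdot|$ is the associated absolute value, $|x|=c^{-\nu(x)}$ for a fixed real $c>1$. $A_d=\{Q\in F[t]:\deg Q<d\}$. Generalized Schneider continued fraction of $z\in\hat K^\times$: for $y\in\hat K^\times$ there is a unique pair $(f,n)\in A_d\times\mathbb{Z}$ with $\nu(yP^n-f)>0$ and $\nu(y)=nd-\deg(f)$. Put $z_1=z$. Given $z_i\ne0$, let $(f_i,n_i)$ be the pair attached to $y=1/z_i$, and put $z_{i+1}=\frac{P^{n_i}}{z_i}-f_i$. If $z_{i+1}=0$, stop and set $N=i$; if this never happens, set $N=\infty$. The convergents of $z$ are $$x_r(z)=\cfrac{P^{n_1}}{f_1+\cfrac{P^{n_2}}{f_2+\cfrac{\ddots}{\ddots+\cfrac{P^{n_r}}{f_r}}}}\in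 K,$$ with $x_0(z)=0$. *)

(* Defs.v *)
From HB Require Import structures.
From mathcomp Require Import all_boot all_order all_algebra.
From mathcomp Require Import fraction generic_quotient.
From mathcomp Require Import zify.
From mathcomp Require Import boolp reals constructive_ereal.

Set Implicit Arguments.
Unset Strict Implicit.
Unset Printing Implicit Defensive.

Import Order.TTheory GRing.Theory Num.Theory.
Local Open Scope ring_scope.

(** Formal power series [F[[s]]]; the variable [s] stands for [t^-1]. *)
Record pseries (F : fieldType) := PSeries { pcoef : nat -> F }.

Section PowerSeries.
Variable F : fieldType.
Implicit Types (a b c : pseries F) (p q : {poly F}).

HB.instance Definition _ := gen_eqMixin (pseries F).
HB.instance Definition _ := gen_choiceMixin (pseries F).

Lemma pseriesP a b : pcoef a =1 pcoef b <-> a = b.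
Proof.
split=> [|-> //]; case: a b => [a] [b] /= ab; congr PSeries; exact/funext.
Qed.

Definition ps_zero : pseries F := PSeries (fun=> 0).
Definition ps_opp a := PSeries (fun n => - pcoef a n).
Definition ps_add a b := PSeries (fun n => pcoef a n + pcoef b n).
Definition psC (x : F) := PSeries (fun n => if n == 0%N then x else 0).
Definition psX : pseries F := PSeries (fun n => (n == 1)%N%:R).
Definition ps_mul a b :=
  PSeries (fun n => \sum_(i < n.+1) pcoef a i * pcoef b (n - i)%N).

Lemma ps_addA : associative ps_add.
Proof. by move=> a b c; apply/pseriesP => n /=; rewrite addrA. Qed.
Lemma ps_addC : commutative ps_add.
Proof. by move=> a b; apply/pseriesP => n /=; rewrite addrC. Qed.
Lemma ps_add0 : left_id ps_zero ps_add.
Proof. by move=> a; apply/pseriesP => n /=; rewrite add0r. Qed.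
Lemma ps_addN : left_inverse ps_zero ps_opp ps_add.
Proof. by move=> a; apply/pseriesP => n /=; rewrite addNr. Qed.

HB.instance Definition _ :=
  GRing.isZmodule.Build (pseries F) ps_addA ps_addC ps_add0 ps_addN.

Definition ps_trunc n a : {poly F} := \poly_(i < n.+1) pcoef a i.

Lemma coef_trunc n a i : (i <= n)%N -> (ps_trunc n a)`_i = pcoef a i.
Proof. by move=> le_in; rewrite coef_poly ltnS le_in. Qed.

Lemma coef_truncM n a b i : (i <= n)%N ->
  (ps_trunc n a * ps_trunc n b)`_i = pcoef (ps_mul a b) i.
Proof.
move=> le_in; rewrite coefM /=; apply: eq_bigr => j _.
rewrite !coef_trunc // ?(leq_trans (leq_subr _ _)) //.
by rewrite (leq_trans _ le_in) // -ltnS.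
Qed.

Lemma coefM_le p p' q q' n : (forall i, (i <= n)%N -> p`_i = p'`_i) ->
  (forall i, (i <= n)%N -> q`_i = q'`_i) -> (p * q)`_n = (p' * q')`_n.
Proof.
move=> pp qq; rewrite !coefM; apply: eq_bigr => j _.
by rewrite pp ?qq ?leq_subr // -ltnS.
Qed.

Lemma ps_mulA : associative ps_mul.
Proof.
move=> a b c; apply/pseriesP => n; rewrite -!(@coef_truncM n) //.
transitivity ((ps_trunc n a * (ps_trunc n b * ps_trunc n c))`_n).
  by apply: coefM_le => // i le_in; rewrite coef_truncM ?coef_trunc.
rewrite mulrA.
by apply: coefM_le => // i le_in; rewrite coef_truncM ?coef_trunc.
Qed.

Lemma ps_mulC : commutative ps_mul.
Proof.
by move=> a b; apply/pseriesP => n; rewrite -!(@coef_truncM n) // mulrC.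
Qed.

Lemma ps_mul1 : left_id (psC 1) ps_mul.
Proof.
move=> a; apply/pseriesP => n /=; rewrite big_ord_recl /= mul1r subn0.
by rewrite big1 ?addr0 // => i _; rewrite mul0r.
Qed.

Lemma ps_mulDl : left_distributive ps_mul ps_add.
Proof.
move=> a b c; apply/pseriesP => n /=; rewrite -big_split /=.
by apply: eq_bigr => i _; rewrite mulrDl.
Qed.

Lemma ps_oner_neq0 : psC 1 != 0.
Proof.
apply/eqP => /pseriesP /(_ 0%N) /= h; have := oner_neq0 F.
by rewrite h eqxx.
Qed.

HB.instance Definition _ := GRing.Zmodule_isComNzRing.Build (pseries F)
  ps_mulA ps_mulC ps_mul1 ps_mulDl ps_oner_neq0.

Lemma pcoef0 n : pcoef (0 : pseries F) n = 0. Proof. by []. Qed.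
Lemma pcoefD a b n : pcoef (a + b) n = pcoef a n + pcoef b n.
Proof. by []. Qed.
Lemma pcoefB a b n : pcoef (a - b) n = pcoef a n - pcoef b n.
Proof. by []. Qed.
Lemma pcoefM a b n :
  pcoef (a * b) n = \sum_(i < n.+1) pcoef a i * pcoef b (n - i)%N.
Proof. by []. Qed.

Lemma psC_is_zmod_morphism : zmod_morphism psC.
Proof.
move=> x y; apply/pseriesP => n; rewrite pcoefB /=.
by case: eqP => // _; rewrite subr0.
Qed.
HB.instance Definition _ :=
  GRing.isZmodMorphism.Build F (pseries F) psC psC_is_zmod_morphism.

Lemma pcoefCM x a n : pcoef (psC x * a) n = x * pcoef a n.
Proof.
rewrite pcoefM big_ord_recl /= subn0 big1 ?addr0 // => i _.
by rewrite mul0r.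
Qed.

Lemma psC_is_monoid_morphism : monoid_morphism psC.
Proof.
split=> // x y; apply/pseriesP => n; rewrite pcoefCM /=.
by case: eqP => // _; rewrite mulr0.
Qed.
HB.instance Definition _ :=
  GRing.isMonoidMorphism.Build F (pseries F) psC psC_is_monoid_morphism.

(* The coefficients [b 0, ..., b n] of the inverse of [a], when [a 0 <> 0]. *)
Fixpoint ps_inv_seq a (n : nat) : seq F :=
  if n is n'.+1 then
    let l := ps_inv_seq a n' in
    rcons l (- (pcoef a 0)^-1 *
             \sum_(i < n'.+1) pcoef a i.+1 * l`_(n' - i))
  else [:: (pcoef a 0)^-1].

Lemma size_ps_inv_seq a n : size (ps_inv_seq a n) = n.+1.
Proof. by elim: n => //= n IHn; rewrite size_rcons IHn. Qed.

Lemma nth_ps_inv_seq a n m : (n <= m)%N ->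
  (ps_inv_seq a m)`_n = (ps_inv_seq a n)`_n.
Proof.
elim: m => [|m IHm]; first by rewrite leqn0 => /eqP->.
rewrite leq_eqVlt => /predU1P[-> //|lt_nm] /=.
by rewrite nth_rcons size_ps_inv_seq lt_nm IHm.
Qed.

Definition ps_unit : pred (pseries F) := fun a => pcoef a 0 != 0.
Definition ps_inv a :=
  if ps_unit a then PSeries (fun n => (ps_inv_seq a n)`_n) else a.

Lemma ps_mulVr : {in ps_unit, left_inverse 1 ps_inv *%R}.
Proof.
move=> a ua; rewrite mulrC; apply/pseriesP => n; rewrite pcoefM.
have a0 : pcoef a 0 != 0 by [].
rewrite /ps_inv [ps_unit a]ua /= big_ord_recl subn0.
case: n => [|n] /=; first by rewrite big_ord0 addr0 divff.
rewrite nth_rcons size_ps_inv_seq ltnn eqxx mulNr mulrN mulVKf //.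
rewrite [X in - X + _](_ : _ =
  \sum_(i < n.+1) pcoef a i.+1 * (ps_inv_seq a (n - i))`_(n - i)).
  by rewrite addNr.
by apply: eq_bigr => i _; rewrite nth_ps_inv_seq ?leq_subr.
Qed.

Lemma ps_unitP a b : b * a = 1 -> ps_unit a.
Proof.
move=> /pseriesP /(_ 0%N); rewrite pcoefM big_ord_recl big_ord0 addr0 /=.
by move=> ba1; apply: contra_eqN ba1 => /eqP ->; rewrite mulr0 eq_sym oner_neq0.
Qed.

Lemma ps_inv_out : {in [predC ps_unit], ps_inv =1 id}.
Proof. by move=> a /negbTE nua; rewrite /ps_inv [ps_unit a]nua. Qed.

HB.instance Definition _ := GRing.ComNzRing_hasMulInverse.Build (pseries F)
  ps_mulVr ps_unitP ps_inv_out.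

Lemma ps_neq0P a : reflect (exists n, pcoef a n != 0) (a != 0).
Proof.
apply: (iffP idP) => [a0|[n an0]]; last first.
  by apply: contraNneq an0 => ->; rewrite pcoef0.
apply: contrapT => /forallNP an0; move/eqP: a0; apply; apply/pseriesP => n.
by apply/eqP; rewrite pcoef0; apply: contrapT => /negP /(an0 n).
Qed.

(* Order of vanishing at [s = 0]; the value at the zero series is irrelevant. *)
Definition ps_ord a : nat :=
  if @idP (a != 0) is ReflectT a0 then ex_minn (ps_neq0P a a0) else 0.

Lemma ps_ordP a : a != 0 ->
  pcoef a (ps_ord a) != 0 /\ (forall n, (n < ps_ord a)%N -> pcoef a n = 0).
Proof.
move=> a0; rewrite /ps_ord; case: {-}_ / idP => [a0'|/(_ a0) //].
case: ex_minnP => m am le_m; split=> // n lt_nm; apply/eqP.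
by apply: contraTT lt_nm => /le_m; rewrite -leqNgt.
Qed.

Lemma pcoefM_ord a b : a != 0 -> b != 0 ->
  pcoef (a * b) (ps_ord a + ps_ord b) =
    pcoef a (ps_ord a) * pcoef b (ps_ord b).
Proof.
move=> /ps_ordP[_ a0] /ps_ordP[_ b0]; rewrite pcoefM.
have lt_a : (ps_ord a < (ps_ord a + ps_ord b).+1)%N by rewrite ltnS leq_addr.
rewrite (bigD1 (Ordinal lt_a)) //= addKn big1 ?addr0 // => i ne_i.
have {ne_i} : (i != ps_ord a :> nat) by [].
rewrite neq_ltn => /orP[/a0->|lt_i]; first by rewrite mul0r.
by rewrite b0 ?mulr0 // (ltn_subLR _ (ltnSE (ltn_ord i))) ltn_add2r.
Qed.

Lemma ps_mulf_eq0 a b : a * b = 0 -> (a == 0) || (b == 0).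
Proof.
move=> ab0; apply: contraPT ab0; rewrite negb_or => /andP[a0 b0].
move/pseriesP => /(_ (ps_ord a + ps_ord b)%N); rewrite pcoefM_ord // pcoef0.
apply/eqP; rewrite mulf_neq0 //; first by case: (ps_ordP a0).
by case: (ps_ordP b0).
Qed.

HB.instance Definition _ :=
  GRing.ComUnitRing_isIntegral.Build (pseries F) ps_mulf_eq0.

Lemma ps_ord_eq a n : pcoef a n != 0 -> (forall m, (m < n)%N -> pcoef a m = 0) ->
  ps_ord a = n.
Proof.
move=> an0 a0; have /ps_ordP[o0 o_min] : a != 0 by apply/ps_neq0P; exists n.
case: (ltngtP (ps_ord a) n) => // [/a0|/o_min] h.
  by rewrite h eqxx in o0.
by rewrite h eqxx in an0.
Qed.

Lemma ps_ordM a b : a != 0 -> b != 0 -> ps_ord (a * b) = (ps_ord a + ps_ord b)%N.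
Proof.
move=> a0 b0; have [oa za] := ps_ordP a0; have [ob zb] := ps_ordP b0.
apply: ps_ord_eq => [|m lt_m]; first by rewrite pcoefM_ord // mulf_neq0.
rewrite pcoefM big1 // => i _; case: (ltnP i (ps_ord a)) => [/za->|le_i].
  by rewrite mul0r.
rewrite zb ?mulr0 // (ltn_subLR _ (ltnSE (ltn_ord i))).
by rewrite (leq_trans lt_m) // leq_add2r.
Qed.

Lemma ps_ord_le a n : pcoef a n != 0 -> (ps_ord a <= n)%N.
Proof.
move=> an0; have /ps_ordP[_ o_min] : a != 0 by apply/ps_neq0P; exists n.
by rewrite leqNgt; apply: contra an0 => /o_min ->.
Qed.

Lemma ps_ordD a b : a + b != 0 -> a != 0 -> b != 0 ->
  (minn (ps_ord a) (ps_ord b) <= ps_ord (a + b)%R)%N.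
Proof.
move=> /ps_ordP[o _] a0 b0; rewrite geq_min.
have [pa|/ps_ord_le -> //] := eqVneq (pcoef a (ps_ord (a + b))) 0.
by rewrite [X in _ || X]ps_ord_le ?orbT //; rewrite pcoefD pa add0r in o.
Qed.

Lemma pcoefXM a n : pcoef (psX * a) n = if n is n'.+1 then pcoef a n' else 0.
Proof.
rewrite pcoefM big_ord_recl /= mul0r add0r; case: n => [|n].
  by rewrite big_ord0.
rewrite big_ord_recl /= mul1r subSS subn0 big1 ?addr0 // => i _.
by rewrite mul0r.
Qed.

Lemma pcoefXn k n : pcoef (psX ^+ k) n = (n == k)%:R.
Proof.
elim: k n => [|k IHk] n; first by rewrite expr0 /=; case: eqP.
by rewrite exprS pcoefXM; case: n => [|n] //; rewrite IHk eqSS.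
Qed.

Lemma psX_neq0 : psX != 0.
Proof. by apply/ps_neq0P; exists 1%N; rewrite /= oner_neq0. Qed.

Lemma ps_ordXn k : ps_ord (psX ^+ k) = k.
Proof.
apply: ps_ord_eq => [|m lt_mk]; rewrite pcoefXn ?eqxx ?oner_neq0 //.
by rewrite ltn_eqF.
Qed.
End PowerSeries.

Notation ratfun F := {fraction {poly F}}.
Notation laurent F := {fraction (pseries F)}.
Notation "x %:F" := (FracField.tofrac x).

Section Fractions.
Variable R : idomainType.

Lemma frac_repr (x : {fraction R}) :
  x * (\d_(repr x))%:F = (\n_(repr x))%:F.
Proof.
elim/quotP: x => r ->.
unlock FracField.tofrac; rewrite -[LHS]FracField.pi_mul.
apply/eqmodP; rewrite /= FracField.equivfE /FracField.mulf /=.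
by rewrite !numden_Ratio ?mulf_neq0 ?oner_neq0 ?denom_ratioP // !mulr1 mulrC.
Qed.

Lemma fracP (x : {fraction R}) : exists a b : R, b != 0 /\ x = a%:F / b%:F.
Proof.
exists \n_(repr x), \d_(repr x); split; first exact: denom_ratioP.
by rewrite -frac_repr mulfK // tofrac_eq0 denom_ratioP.
Qed.

Lemma frac_eq (a b c d : R) : b != 0 -> d != 0 ->
  (a%:F / b%:F == c%:F / d%:F) = (a * d == c * b).
Proof.
by move=> b0 d0; rewrite eqr_div ?tofrac_eq0 // -!tofracM tofrac_eq.
Qed.
End Fractions.

Section Laurent.
Variable F : fieldType.
Implicit Types (a b : pseries F) (p q : {poly F}) (x y : laurent F).

(* The order in [s = t^-1], with [nu 0 = +oo]; see [nu_toL] for its values on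
   [F(t)]. *)
Definition nu x : \bar int :=
  if x == 0 then +oo%E
  else ((ps_ord \n_(repr x))%:Z - (ps_ord \d_(repr x))%:Z)%:E.
Arguments nu x%_R.

Lemma nu0 : nu 0 = +oo%E. Proof. by rewrite /nu eqxx. Qed.

Lemma nu_frac a b : a != 0 -> b != 0 ->
  nu (a%:F / b%:F) = ((ps_ord a)%:Z - (ps_ord b)%:Z)%:E.
Proof.
move=> a0 b0; set x := _ / _.
have x0 : x != 0 by rewrite mulf_neq0 ?invr_eq0 ?tofrac_eq0.
have d0 : \d_(repr x) != 0 by exact: denom_ratioP.
have n0 : \n_(repr x) != 0.
  by rewrite -tofrac_eq0 -frac_repr mulf_neq0 ?tofrac_eq0.
rewrite /nu (negbTE x0); congr (_%:E).
have /eqP : x = (\n_(repr x))%:F / (\d_(repr x))%:F.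
  by rewrite -frac_repr mulfK // tofrac_eq0.
rewrite {1}/x frac_eq // => /eqP /(congr1 (@ps_ord F)).
rewrite !ps_ordM // => e; apply/eqP.
by rewrite subr_eq addrAC eq_sym subr_eq -!PoszD e.
Qed.

Lemma nu1 : nu 1 = 0%:E.
Proof.
by rewrite -(divr1 1) -tofrac1 nu_frac ?oner_neq0 // subrr.
Qed.

Lemma laurent_neq0P x : x != 0 ->
  exists a b, [/\ a != 0, b != 0 & x = a%:F / b%:F].
Proof.
have [a [b [b0 ->]]] := fracP x => x0; exists a, b; split=> //.
by apply: contraNneq x0 => ->; rewrite tofrac0 mul0r.
Qed.

Lemma nu_fin x : x != 0 -> exists k, nu x = k%:E.
Proof. by rewrite /nu => /negbTE ->; eexists. Qed.

Lemma nuM x y : nu (x * y) = (nu x + nu y)%E.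
Proof.
have [->|x0] := eqVneq x 0.
  rewrite mul0r nu0; have [->|/nu_fin[k ->]//] := eqVneq y 0.
  by rewrite nu0.
have [->|y0] := eqVneq y 0.
  by rewrite mulr0 nu0; have [k ->] := nu_fin x0.
have [a [b [a0 b0 ->]]] := laurent_neq0P x0.
have [c [d [c0 d0 ->]]] := laurent_neq0P y0.
rewrite mulf_div -!tofracM !nu_frac ?mulf_neq0 // !ps_ordM // -EFinD.
by rewrite !PoszD opprD addrACA.
Qed.

Lemma nu_inv x k : nu x = k%:E -> nu x^-1 = (- k)%:E.
Proof.
have [->|x0] := eqVneq x 0; first by rewrite nu0.
have [a [b [a0 b0 ->]]] := laurent_neq0P x0.
by rewrite invf_div !nu_frac // => -[<-]; rewrite opprB.
Qed.

Lemma nuN x : nu (- x) = nu x.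
Proof.
have [->|x0] := eqVneq x 0; first by rewrite oppr0.
rewrite -mulN1r nuM -[RHS]add0e; congr (_ + _)%E.
have [k ek] : exists k, nu (- 1 : laurent F) = k%:E.
  by apply: nu_fin; rewrite oppr_eq0 oner_neq0.
have := nuM (-1) (-1); rewrite mulrNN mulr1 ek -EFinD.
rewrite nu1 => -[] /esym/eqP; rewrite -mulr2n mulrn_eq0 /= => /eqP->.
by [].
Qed.

Lemma nuD x y : (Order.min (nu x) (nu y) <= nu (x + y))%E.
Proof.
have [->|x0] := eqVneq x 0; first by rewrite add0r ge_min lexx orbT.
have [->|y0] := eqVneq y 0; first by rewrite addr0 ge_min lexx.
have [->|s0] := eqVneq (x + y) 0; first by rewrite nu0 leey.
move: s0.
have [a [b [a0 b0 ->]]] := laurent_neq0P x0.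
have [c [d [c0 d0 ->]]] := laurent_neq0P y0.
have bd0 : b * d != 0 by rewrite mulf_neq0.
have e1 : a%:F / b%:F = (a * d)%:F / (b * d)%:F.
  by apply/eqP; rewrite frac_eq // mulrAC mulrA.
have e2 : c%:F / d%:F = (c * b)%:F / (b * d)%:F.
  by apply/eqP; rewrite frac_eq // mulrA.
rewrite e1 e2 -mulrDl -tofracD => s0.
have ad0 : a * d != 0 by rewrite mulf_neq0.
have cb0 : c * b != 0 by rewrite mulf_neq0.
have s0' : a * d + c * b != 0.
  by apply: contraNneq s0 => ->; rewrite tofrac0 mul0r.
rewrite !nu_frac // ge_min !lee_fin !lerD2r !lez_nat -geq_min.
exact: ps_ordD.
Qed.

Lemma nuD_gt x y : (nu x < nu y)%E -> nu (x + y) = nu x.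
Proof.
move=> lt_xy; apply/eqP; rewrite eq_le; apply/andP; split; last first.
  by apply: le_trans (nuD x y); rewrite le_min lexx ltW.
have := nuD (x + y) (- y); rewrite addrK nuN ge_min => /orP[//|].
by rewrite leNgt lt_xy.
Qed.

(* Elements of [F((s))] are the Laurent series [s^-m * c] with [c] in
   [F[[s]]]. *)
Lemma laurentP x : exists (c : pseries F) m, x = c%:F / (psX F)%:F ^+ m.
Proof.
have [a [b [b0 ->]]] := fracP x.
have [bo bz] := ps_ordP b0; set m := ps_ord b in bo bz.
pose u := PSeries (fun i => pcoef b (i + m)).
have bE : b = psX F ^+ m * u.
  apply/pseriesP => i; rewrite pcoefM.
  case: (ltnP i m) => [lt_im|le_mi].
    rewrite bz // big1 // => j _; rewrite pcoefXn ltn_eqF ?mul0r //.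
    by rewrite (leq_ltn_trans _ lt_im) // -ltnS.
  have lt_m : (m < i.+1)%N by [].
  rewrite (bigD1 (Ordinal lt_m)) //= pcoefXn eqxx mul1r subnK // big1 ?addr0 //.
  by move=> j /negbTE jm; rewrite pcoefXn [_ == m]jm mul0r.
have uu : u \is a GRing.unit by rewrite unfold_in /= /ps_unit /= add0n.
have X0 : psX F ^+ m != 0 by rewrite expf_neq0 ?psX_neq0.
exists (a / u), m; apply/eqP; rewrite -tofracXn frac_eq // bE.
by rewrite mulrA mulrAC divrK // mulrC mulrA [X in _ == X]mulrC.
Qed.

Definition constL (c : F) : laurent F := (psC c)%:F.

Lemma constL_is_zmod_morphism : zmod_morphism constL.
Proof. by move=> c c'; rewrite /constL !rmorphB. Qed.
Lemma constL_is_monoid_morphism : monoid_morphism constL.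
Proof. by split=> [|c c']; rewrite /constL ?rmorphM ?rmorph1. Qed.
HB.instance Definition _ :=
  GRing.isZmodMorphism.Build F (laurent F) constL constL_is_zmod_morphism.
HB.instance Definition _ :=
  GRing.isMonoidMorphism.Build F (laurent F) constL constL_is_monoid_morphism.

(* [t] is sent to [s^-1]. *)
Definition polyL p : laurent F := (map_poly constL p).[(psX F)%:F^-1].

Lemma polyL_is_zmod_morphism : zmod_morphism polyL.
Proof. by move=> p q; rewrite /polyL rmorphB hornerD hornerN. Qed.
Lemma polyL_is_monoid_morphism : monoid_morphism polyL.
Proof.
by split=> [|p q]; rewrite /polyL ?rmorph1 ?hornerC // rmorphM hornerM.
Qed.
HB.instance Definition _ :=
  GRing.isZmodMorphism.Build {poly F} (laurent F) polyL polyL_is_zmod_morphism.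
HB.instance Definition _ := GRing.isMonoidMorphism.Build {poly F} (laurent F)
  polyL polyL_is_monoid_morphism.

Definition ps_rev n p : pseries F :=
  PSeries (fun k => if (k <= n)%N then p`_(n - k) else 0).

Lemma polyL_rev n p : (size p <= n.+1)%N ->
  polyL p = (ps_rev n p)%:F / (psX F)%:F ^+ n.
Proof.
move=> le_p; have X0 : (psX F)%:F != 0 by rewrite tofrac_eq0 psX_neq0.
have revE : ps_rev n p = \sum_(i < n.+1) psC p`_i * psX F ^+ (n - i).
  apply/pseriesP => k.
  have pcoef_sum (G : 'I_n.+1 -> pseries F) :
      pcoef (\sum_i G i) k = \sum_i pcoef (G i) k.
    by apply: (big_morph (fun a => pcoef a k)).
  rewrite pcoef_sum (eq_bigr (fun i : 'I_n.+1 => p`_i * (k == n - i)%N%:R)).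
    rewrite /=; case: leqP => [le_kn|lt_nk]; last first.
      rewrite big1 // => i _; rewrite gtn_eqF ?mulr0 //.
      by rewrite (leq_ltn_trans (leq_subr _ _)).
    have lt_nk : (n - k < n.+1)%N by rewrite ltnS leq_subr.
    rewrite (bigD1 (Ordinal lt_nk)) //= subKn // eqxx mulr1.
    rewrite big1 ?addr0 // => i ne_i.
    case: eqP => [ek|_]; last by rewrite mulr0.
    case/eqP: ne_i; apply/val_inj => /=.
    by rewrite ek subKn // -ltnS.
  by move=> i _; rewrite pcoefCM pcoefXn.
have le_mp : (size (map_poly constL p) <= n.+1)%N.
  by apply: leq_trans le_p; exact: size_poly.
rewrite /polyL (horner_coef_wide _ le_mp) revE rmorph_sum mulr_suml.
apply: eq_bigr => i _; rewrite coef_map /= rmorphM rmorphXn -mulrA exprVn.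
congr (_ * _); apply: (mulfI (expf_neq0 i X0)).
rewrite divff ?expf_neq0 // mulrA -exprD subnKC ?(ltnSE (ltn_ord i)) // divff //.
by rewrite expf_neq0.
Qed.

(** The degree, with [deg 0 = -oo]. *)
Definition deg p : \bar int :=
  if p == 0 then -oo%E else ((size p).-1%:Z)%:E.

Lemma nu_polyL p : nu (polyL p) = (- deg p)%E.
Proof.
have [->|p0] := eqVneq p 0; first by rewrite rmorph0 nu0 /deg eqxx.
rewrite (@polyL_rev (size p).-1) ?leqSpred // -tofracXn.
have c0 : pcoef (ps_rev (size p).-1 p) 0 != 0.
  by rewrite /= subn0 -lead_coefE lead_coef_eq0.
have r0 : ps_rev (size p).-1 p != 0 by apply/ps_neq0P; exists 0%N.
rewrite nu_frac ?expf_neq0 ?psX_neq0 // ps_ordXn (ps_ord_eq c0) //.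
by rewrite sub0r /deg (negbTE p0) EFinN.
Qed.

Lemma polyL_eq0 p : (polyL p == 0) = (p == 0).
Proof.
apply/eqP/eqP => [p0|->]; last exact: rmorph0.
have := nu_polyL p; rewrite p0 nu0 /deg.
by case: eqP.
Qed.

Definition toL (x : ratfun F) : laurent F :=
  polyL \n_(repr x) / polyL \d_(repr x).
Arguments toL x%_R.

Lemma toL_frac p q : q != 0 -> toL (p%:F / q%:F) = polyL p / polyL q.
Proof.
move=> q0; rewrite /toL; set x := p%:F / q%:F.
have d0 : \d_(repr x) != 0 by exact: denom_ratioP.
have /eqP : x = (\n_(repr x))%:F / (\d_(repr x))%:F.
  by rewrite -frac_repr mulfK // tofrac_eq0.
rewrite {1}/x frac_eq // => /eqP e; apply/eqP.
by rewrite eqr_div ?polyL_eq0 // -!rmorphM e.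
Qed.

Lemma toL_poly p : toL p%:F = polyL p.
Proof.
by have := toL_frac p (oner_neq0 _); rewrite tofrac1 rmorph1 !divr1.
Qed.

Lemma toL_is_zmod_morphism : zmod_morphism toL.
Proof.
move=> x y; have [a [b [b0 ->]]] := fracP x; have [c [d [d0 ->]]] := fracP y.
have e : a%:F / b%:F - c%:F / d%:F = (a * d - c * b)%:F / (b * d)%:F.
  by rewrite -mulNr addf_div ?tofrac_eq0 // tofracM tofracB !tofracM mulNr.
rewrite e !toL_frac ?mulf_neq0 // rmorphB !rmorphM -[- (_ / _)]mulNr.
by rewrite addf_div ?polyL_eq0 // mulNr.
Qed.
Lemma toL_is_monoid_morphism : monoid_morphism toL.
Proof.
split=> [|x y]; first by rewrite -tofrac1 toL_poly rmorph1.
have [a [b [b0 ->]]] := fracP x; have [c [d [d0 ->]]] := fracP y.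
rewrite mulf_div -!tofracM !toL_frac ?mulf_neq0 // !rmorphM.
by rewrite mulf_div.
Qed.
HB.instance Definition _ := GRing.isZmodMorphism.Build (ratfun F) (laurent F)
  toL toL_is_zmod_morphism.
HB.instance Definition _ := GRing.isMonoidMorphism.Build (ratfun F) (laurent F)
  toL toL_is_monoid_morphism.

Lemma nu_toL_poly p : nu (toL p%:F) = (- deg p)%E.
Proof. by rewrite toL_poly nu_polyL. Qed.

Lemma nu_toL p q : q != 0 -> nu (toL (p%:F / q%:F)) = (deg q - deg p)%E.
Proof.
move=> q0; rewrite toL_frac // nuM nu_polyL addeC; congr (_ + _)%E.
have := nu_polyL q; rewrite /deg (negbTE q0) -EFinN => /nu_inv ->.
by rewrite opprK.
Qed.

Definition absv (R : realType) (c : R) (x : laurent F) : R :=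
  if nu x is k%:E then c ^ (- k) else 0.

(** The pair [(f, n)] of [A_d * int] attached to [y]. *)
Definition schneider_pair (P : {poly F}) (d : nat) (y : laurent F)
    (f : {poly F}) (n : int) : Prop :=
  [/\ (deg f < d%:Z%:E)%E,
      (0 < nu (y * toL P%:F ^ n - toL f%:F))%E
    & nu y = ((n * d%:Z)%:E - deg f)%E].

(** [i <= N], where [N = None] stands for an infinite expansion. *)
Definition leN (i : nat) (N : option nat) : bool :=
  if N is Some m then (i <= m)%N else true.

(** [(n i, f i)], for [1 <= i <= N], is the sequence defining the generalized
    Schneider continued fraction of [z]; other indices are unconstrained. *)
Definition schneider_cf (P : {poly F}) (d : nat) (z : laurent F)
    (N : option nat) (n : nat -> int) (f : nat -> {poly F}) : Prop :=
  exists zs : nat -> laurent F,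
  [/\ zs 1%N = z,
      forall i, (0 < i)%N -> leN i N ->
        [/\ zs i != 0, schneider_pair P d (zs i)^-1 (f i) (n i)
          & zs i.+1 = toL P%:F ^ n i / zs i - toL (f i)%:F]
    & forall m, N = Some m -> zs m.+1 = 0].

(* [r] levels of the continued fraction, starting from the index [i]. *)
Fixpoint cfrac (P : {poly F}) (n : nat -> int) (f : nat -> {poly F})
    (i r : nat) : ratfun F :=
  if r is r'.+1 then P%:F ^ n i / ((f i)%:F + cfrac P n f i.+1 r') else 0.

Definition convergent (P : {poly F}) (n : nat -> int) (f : nat -> {poly F})
    (r : nat) : ratfun F := cfrac P n f 1 r.

(** The subring [A[1/P]] of [F(t)]. *)
Definition inA_P (P : {poly F}) (x : ratfun F) : Prop :=
  exists (a : {poly F}) (k : nat), x = a%:F / P%:F ^+ k.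

Lemma poly_part x : exists f : {poly F}, (0 < nu (x - toL f%:F))%E.
Proof.
have [c [m ->]] := laurentP x.
exists (\poly_(i < m.+1) pcoef c (m - i)).
rewrite toL_poly (@polyL_rev m) ?size_poly // -mulrBl -tofracB -tofracXn.
set b := _ - _; have [->|b0] := eqVneq b 0.
  by rewrite tofrac0 mul0r nu0.
rewrite nu_frac ?expf_neq0 ?psX_neq0 // ps_ordXn lte_fin subr_gt0 ltz_nat.
rewrite ltnNge; apply/negP => le_m; have [/eqP[]] := ps_ordP b0.
rewrite pcoefB /= le_m coef_poly ltnS leq_subr subKn //.
by rewrite subrr.
Qed.

Lemma schneider_pair_ex (P : {poly F}) d y : size P = d.+1 -> (0 < d)%N ->
  y != 0 -> exists f n, schneider_pair P d y f n.
Proof.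
move=> sP d0 y0; have [v ev] := nu_fin y0.
have dz : d%:Z != 0 by rewrite eqz_nat -lt0n.
have P0 : P != 0 by rewrite -size_poly_eq0 sP.
pose n : int := - ((- v) %/ d%:Z)%Z; pose r : int := ((- v) %% d%:Z)%Z.
have nuP : nu (toL P%:F) = (- d%:Z)%:E.
  by rewrite nu_toL_poly /deg (negbTE P0) sP.
have nuPn k : nu (toL P%:F ^ k) = (- (k * d%:Z))%:E.
  have nat_case (j : nat) : nu (toL P%:F ^+ j) = (- (j%:Z * d%:Z))%:E.
    elim: j => [|j IHj].
      by rewrite expr0 nu1 mul0r oppr0.
    by rewrite exprS nuM IHj nuP -EFinD -opprD intS mulrDl mul1r.
  case: k => j; first exact: nat_case.
  by rewrite NegzE -exprnN (nu_inv (nat_case _)) mulNr.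
have nuw : nu (y * toL P%:F ^ n) = (- r)%:E.
  rewrite nuM ev nuPn -EFinD; congr (_%:E).
  rewrite -[v]opprK {1}(divz_eq (- v) d%:Z) /n /r mulNr opprK opprD.
  by rewrite addrAC addNr add0r.
have [f nuf] := poly_part (y * toL P%:F ^ n).
have ef : nu (toL f%:F) = (- r)%:E.
  have -> : toL f%:F = y * toL P%:F ^ n - (y * toL P%:F ^ n - toL f%:F).
    by rewrite opprB addrC subrK.
  rewrite nuD_gt nuw // nuN (le_lt_trans _ nuf) // lee_fin oppr_le0.
  exact: modz_ge0.
have df : deg f = r%:E.
  move: ef; rewrite nu_toL_poly => /(congr1 (fun e => - e)%E).
  by rewrite oppeK -EFinN opprK.
exists f, n; split=> //; first by rewrite df lte_fin ltz_pmod.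
rewrite df -EFinN -EFinD ev; congr (_%:E).
rewrite -[v in LHS]opprK {1}(divz_eq (- v) d%:Z) /n /r mulNr opprD.
by [].
Qed.

Lemma schneider_pair_uniq (P : {poly F}) d y f f' n n' : size P = d.+1 ->
  (0 < d)%N -> y != 0 ->
  schneider_pair P d y f n -> schneider_pair P d y f' n' -> f = f' /\ n = n'.
Proof.
move=> sP d0 y0 [df nuf ey] [df' nuf' ey']; have [v ev] := nu_fin y0.
have f0 : f != 0 by apply/eqP => f0; move: ey; rewrite ev /deg f0 eqxx.
have f0' : f' != 0 by apply/eqP => f0'; move: ey'; rewrite ev /deg f0' eqxx.
move: df ey df' ey'; rewrite ev /deg (negbTE f0) (negbTE f0') !lte_fin !ltz_nat.
move=> df [vE] df' [vE'].
have en : n = n'.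
  have : (n * d%:Z + ((size f').-1)%:Z)%R = (n' * d%:Z + ((size f).-1)%:Z)%R.
    move: vE; rewrite vE' => /eqP.
    by rewrite subr_eq addrAC eq_sym subr_eq => /eqP.
  move/(congr1 (fun k => (k %/ d%:Z)%Z)).
  have dz : d%:Z != 0 by rewrite eqz_nat -lt0n.
  by rewrite !divzMDl // !divz_small ?addr0 //=; apply/andP; split; lia.
split=> //; apply/eqP; rewrite -subr_eq0; apply/negPn/negP => ff'.
have : (0 < nu (toL (f - f')%:F))%E.
  set w := y * _ in nuf; have -> : toL (f - f')%:F =
    (w - toL f'%:F) + - (w - toL f%:F).
    by rewrite tofracB rmorphB opprB [RHS]addrC addrA subrK.
  by apply: lt_le_trans (nuD _ _); rewrite lt_min nuN nuf /w en nuf'.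
by rewrite nu_toL_poly /deg (negbTE ff') -EFinN lte_fin oppr_gt0.
Qed.

Lemma schneider_cf_ex (P : {poly F}) d z : size P = d.+1 -> (0 < d)%N ->
  z != 0 -> exists N n f, schneider_cf P d z N n f.
Proof.
move=> sP d0 z0.
have /choice[g gP] : forall y : laurent F, exists fn : {poly F} * int,
    y != 0 -> schneider_pair P d y fn.1 fn.2.
  move=> y; have [->|y0] := eqVneq y 0; first by exists (0, 0).
  by have [f [n fn]] := schneider_pair_ex sP d0 y0; exists (f, n).
pose zs := fix zs i := if i is i'.+1 then
  if i' is 0 then z else
    toL P%:F ^ (g (zs i')^-1).2 / zs i' - toL ((g (zs i')^-1).1)%:F else z.
have zsS i : (0 < i)%N -> zs i.+1 =
    toL P%:F ^ (g (zs i)^-1).2 / zs i - toL ((g (zs i)^-1).1)%:F.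
  by case: i.
pose n i := (g (zs i)^-1).2; pose f i := (g (zs i)^-1).1.
have [[m zm]|nz] := pselect (exists m, zs m.+1 == 0).
  case: (ex_minnP (ex_intro (fun m => zs m.+1 == 0) m zm)) => k /eqP zk min_k.
  exists (Some k), n, f, zs; split=> // [i i0 le_ik|_ [<-] //].
  have zi : zs i != 0.
    case: i i0 le_ik => // i _; apply: contraTneq => /eqP /min_k.
    by rewrite -leqNgt.
  by split; [| apply: gP; rewrite invr_eq0 | apply: zsS].
exists None, n, f, zs; split=> // i i0 _.
have zi : zs i != 0.
  by case: i i0 => // i _; apply/eqP => zi; apply: nz; exists i; apply/eqP.
by split; [| apply: gP; rewrite invr_eq0 | apply: zsS].
Qed.
End Laurent.

Arguments nu {F} x%_R.
Arguments toL {F} x%_R.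

(* Main.v *)
(** Writing [C (i, r)] for the [r]-level continued fraction starting at index
    [i], one has [z_i = P^n_i / (f_i + z_(i+1))] and
    [C (i, r+1) = P^n_i / (f_i + C (i+1, r))], and both denominators have
    valuation [- deg f_i] since their second summand has positive valuation.
    If [C (i+1, r) = p / q], the fraction [C (i, r+1) = (P^n_i q) / (f_i q + p)]
    has a denominator of valuation [nu q - deg f_i], while the error satisfies
    [nu (z_i - C (i, r+1)) =
       nu (z_(i+1) - C (i+1, r)) + 2 deg f_i - n_i d].
    The formula follows by induction on [r], for all [i] at once. *)

Require Import Defs.
From mathcomp Require Import all_boot all_order all_algebra.
From mathcomp Require Import fraction.
From mathcomp Require Import reals constructive_ereal.
From mathcomp Require Import ring.

Import Order.TTheory GRing.Theory Num.Theory.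
Local Open Scope ring_scope.

Lemma nu_eq_fin_neq0 {F : fieldType} {x : laurent F} {k : int} :
  nu x = k%:E -> x != 0.
Proof. by apply: contra_eq_neq => ->; rewrite nu0. Qed.

Lemma nu_exprz {F : fieldType} {x : laurent F} {v : int} (k : int) :
  nu x = v%:E -> nu (x ^ k) = (k * v)%:E.
Proof.
move=> ex; have nat_case (j : nat) : nu (x ^+ j) = (j%:Z * v)%:E.
  elim: j => [|j IHj]; first by rewrite expr0 nu1 mul0r.
  by rewrite exprS nuM IHj ex -EFinD intS mulrDl mul1r.
case: k => j; first exact: nat_case.
by rewrite NegzE -exprnN (nu_inv (nat_case _)) mulNr.
Qed.

Lemma deg_fin {F : fieldType} {p : {poly F}} :
  p != 0 -> exists b : nat, deg p = (b%:Z)%:E.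
Proof. by rewrite /deg => /negbTE ->; eexists. Qed.

Lemma deg_fin_neq0 {F : fieldType} {p : {poly F}} {k : int} :
  deg p = k%:E -> p != 0.
Proof. by apply: contra_eq_neq => ->; rewrite /deg eqxx. Qed.

(** As [nu y] is finite, the third condition on the pair excludes [deg f = -oo]. *)
Lemma schneider_pair_deg {F : fieldType} {P : {poly F}} {d : nat}
    {y : laurent F} {f : {poly F}} {n : int} :
  y != 0 -> schneider_pair P d y f n -> exists b : nat, deg f = (b%:Z)%:E.
Proof.
move=> /nu_fin[v ev] [_ _]; rewrite ev => e; apply: deg_fin.
by apply: contra_eq_neq e => ->; rewrite /deg eqxx.
Qed.

Lemma absv_fin (F : fieldType) (R : realType) (c : R) (x : laurent F) (k : int) :
  nu x = k%:E -> absv c x = c ^ (- k).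
Proof. by rewrite /absv => ->. Qed.

Lemma inA_P0 (F : fieldType) (P : {poly F}) : inA_P P 0.
Proof. by exists 0, 0%N; rewrite tofrac0 mul0r. Qed.

Lemma inA_P_poly (F : fieldType) (P f : {poly F}) : inA_P P f%:F.
Proof. by exists f, 0%N; rewrite expr0 divr1. Qed.

Lemma inA_PM (F : fieldType) (P : {poly F}) (x y : ratfun F) :
  inA_P P x -> inA_P P y -> inA_P P (x * y).
Proof.
move=> [a [k ->]] [b [l ->]]; exists (a * b), (k + l)%N.
by rewrite mulf_div -tofracM exprD.
Qed.

Lemma inA_PD (F : fieldType) (P : {poly F}) (x y : ratfun F) : P != 0 ->
  inA_P P x -> inA_P P y -> inA_P P (x + y).
Proof.
move=> P0 [a [k ->]] [b [l ->]]; exists (a * P ^+ l + b * P ^+ k), (k + l)%N.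
rewrite addf_div ?expf_neq0 ?tofrac_eq0 // tofracD !tofracM !tofracXn exprD.
by [].
Qed.

(** The exponents [n i] may be negative: this is why numerators and denominators are taken in
    [A[1/P]] rather than in [A]. *)
Lemma inA_PXz (F : fieldType) (P : {poly F}) (k : int) : inA_P P (P%:F ^ k).
Proof.
case: k => k; first by exists (P ^+ k), 0%N; rewrite tofracXn divr1.
by exists 1, k.+1; rewrite tofrac1 div1r.
Qed.

Lemma leN_trans (i j : nat) (N : option nat) : (i <= j)%N -> leN j N -> leN i N.
Proof. by case: N => //= m; apply: leq_trans. Qed.

Lemma divfMM {K : fieldType} (x y : K) {q : K} :
  q != 0 -> x * q / (q * y) = x / y.
Proof. by move=> q0; rewrite invfM mulrA mulfK. Qed.

(** Expresses the error at one level through the error [b - c] of the next tail. *)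
Lemma sub_fracD {K : fieldType} (x a : K) {b c : K} :
  a + b != 0 -> a + c != 0 ->
  x / (a + b) - x / (a + c) = - (x * (b - c) / ((a + b) * (a + c))).
Proof. by move=> ab0 ac0; field; rewrite ab0 ac0. Qed.

Section CompleteQuotients.
Context {F : fieldType} {P : {poly F}} {d : nat} {N : option nat}.
Context {n : nat -> int} {f : nat -> {poly F}} {zs : nat -> laurent F}.
Hypothesis deg_P : deg P = (d%:Z)%:E.
Hypothesis zsP : forall i, (0 < i)%N -> leN i N ->
  [/\ zs i != 0, schneider_pair P d (zs i)^-1 (f i) (n i)
    & zs i.+1 = toL P%:F ^ n i / zs i - toL (f i)%:F].

Lemma nu_PXz (k : int) : nu (toL P%:F ^ k) = (- (k * d%:Z))%:E.
Proof.
have e : nu (toL P%:F) = (- d%:Z)%:E by rewrite nu_toL_poly deg_P EFinN.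
by rewrite (nu_exprz k e) mulrN.
Qed.

Lemma PXz_neq0 (k : int) : toL P%:F ^ k != 0.
Proof. exact: nu_eq_fin_neq0 (nu_PXz k). Qed.

Lemma deg_partial i : (0 < i)%N -> leN i N ->
  exists b : nat, deg (f i) = (b%:Z)%:E.
Proof.
move=> i0 iN; have [z0 fP _] := zsP _ i0 iN.
by apply: schneider_pair_deg fP; rewrite invr_eq0.
Qed.

Lemma nu_zs i (b : nat) : (0 < i)%N -> leN i N -> deg (f i) = (b%:Z)%:E ->
  nu (zs i) = (b%:Z - n i * d%:Z)%:E.
Proof.
move=> i0 iN eb; have [z0 [_ _]] := zsP _ i0 iN.
by rewrite eb -EFinN -EFinD => /nu_inv; rewrite invrK opprB.
Qed.

Lemma nu_zsS_gt0 i : (0 < i)%N -> leN i N -> (0 < nu (zs i.+1))%E.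
Proof. by move=> i0 iN; have [_ [_ ? _] ->] := zsP _ i0 iN; rewrite mulrC. Qed.

(** Since [- b <= 0 < nu x], the strict ultrametric inequality lets [f i] dominate. *)
Lemma nu_partialD i (b : nat) x : deg (f i) = (b%:Z)%:E -> (0 < nu x)%E ->
  nu (toL (f i)%:F + x) = (- b%:Z)%:E.
Proof.
move=> eb x0; have ef : nu (toL (f i)%:F) = (- b%:Z)%:E.
  by rewrite nu_toL_poly eb EFinN.
by rewrite nuD_gt ef //; apply: le_lt_trans x0; rewrite lee_fin oppr_le0.
Qed.

Lemma zsE i : (0 < i)%N -> leN i N ->
  zs i = toL P%:F ^ n i / (toL (f i)%:F + zs i.+1).
Proof.
move=> i0 iN; have [z0 _ ->] := zsP _ i0 iN.
by rewrite addrC subrK invf_div mulrC divfK ?PXz_neq0.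
Qed.

Lemma toL_cfracS i r : toL (cfrac P n f i r.+1) =
  toL P%:F ^ n i / (toL (f i)%:F + toL (cfrac P n f i.+1 r)).
Proof. by rewrite /= fmorph_div fmorphXz rmorphD. Qed.

(** The empty tail is 0, of valuation [+oo]. A nonempty one has the same valuation as [zs i.+1],
    both denominators being dominated by [f i.+1]. *)
Lemma nu_cfrac_gt0 i r : (0 < i)%N -> leN (i + r)%N N ->
  (0 < nu (toL (cfrac P n f i.+1 r)))%E.
Proof.
elim: r i => [|r IHr] i i0 iN; first by rewrite rmorph0 nu0.
rewrite -addSnnS in iN.
have iN1 : leN i.+1 N by apply: leN_trans iN; rewrite leq_addr.
have [b eb] := deg_partial i.+1 isT iN1.
have := nu_zsS_gt0 i i0 (leN_trans _ _ _ (leqnSn i) iN1).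
rewrite (nu_zs i.+1 b isT iN1 eb) toL_cfracS nuM nu_PXz.
rewrite (nu_inv (nu_partialD _ _ _ eb (IHr i.+1 isT iN))) opprK -EFinD addrC.
by [].
Qed.

Lemma cfrac_approx i r : (0 < i)%N -> leN (i + r)%N N ->
  exists p q : ratfun F,
    [/\ inA_P P p /\ inA_P P q, q != 0, cfrac P n f i r = p / q
      & exists a b : int,
        [/\ nu (toL q) = a%:E, deg (f (i + r)%N) = b%:E
          & nu (zs i - toL (cfrac P n f i r)) =
            (- (2 * a) + b - \sum_(i <= j < (i + r).+1) n j * d%:Z)%:E]].
Proof.
elim: r i => [|r IHr] i i0.
  rewrite addn0 => iN; have [b eb] := deg_partial i i0 iN.
  (* With no level the approximation is [0 / 1], and the error is [zs i] itself. *)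
  exists 0, 1; split; rewrite ?oner_neq0 ?mul0r //.
    by split; [exact: inA_P0 | rewrite -tofrac1; exact: inA_P_poly].
  exists 0, b%:Z; split; rewrite ?rmorph1 ?nu1 // rmorph0 subr0.
  by rewrite (nu_zs _ _ i0 iN eb) big_nat1 mulr0 oppr0 add0r.
move=> iN; have iN' : leN (i.+1 + r)%N N by rewrite addSnnS.
have leiN : leN i N by apply: leN_trans iN; rewrite leq_addr.
have P0 := deg_fin_neq0 deg_P.
have [b eb] := deg_partial i i0 leiN.
have nuz := nu_partialD _ _ _ eb (nu_zsS_gt0 _ i0 leiN).
have lt_ir : leN (i + r)%N N by apply: leN_trans iN; rewrite leq_add2l.
have nuC := nu_partialD _ _ _ eb (nu_cfrac_gt0 _ _ i0 lt_ir).
have [p [q [[pA qA] q0 eC [a [b' [ea eb' nuE]]]]]] := IHr i.+1 isT iN'.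
(* This factorization gives both the valuation of the new denominator and its nonvanishing. *)
have qE : (f i)%:F * q + p = q * ((f i)%:F + cfrac P n f i.+1 r).
  by rewrite eC mulrDr mulrC mulrCA divff // mulr1.
have nuq : nu (toL ((f i)%:F * q + p)) = (a - b%:Z)%:E.
  by rewrite qE rmorphM rmorphD nuM ea nuC.
have q'0 : (f i)%:F * q + p != 0.
  by apply: contraNneq (nu_eq_fin_neq0 nuq) => ->; rewrite rmorph0.
exists (P%:F ^ n i * q), ((f i)%:F * q + p); split => //.
- split; first by apply: inA_PM => //; apply: inA_PXz.
  by apply: inA_PD => //; apply: inA_PM => //; apply: inA_P_poly.
- by rewrite qE (divfMM _ _ q0).
exists (a - b%:Z), b'; split=> //; first by rewrite -addSnnS.
set C := toL (cfrac P n f i.+1 r) in nuC nuE.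
rewrite (zsE _ i0 leiN) toL_cfracS -/C.
(* Each of the two denominators contributes [b] to the valuation; together they turn [- 2 a] into
   [- 2 (a - b)]. The factor [P ^ n i] supplies the term [j = i] of the sum. *)
rewrite (sub_fracD _ _ (nu_eq_fin_neq0 nuz) (nu_eq_fin_neq0 nuC)).
rewrite nuN !nuM nu_PXz nuE invfM nuM (nu_inv nuz) (nu_inv nuC) -!EFinD.
rewrite addSnnS [in RHS]big_ltn ?ltnS ?leq_addr //; congr (_%:E).
by ring.
Qed.
End CompleteQuotients.

Theorem theorem1p2 (F : fieldType) (P : {poly F}) (d : nat)
    (hd : (1 <= d)%N) (hP : deg P = (d%:Z)%:E)
    (R : realType) (c : R) (hc : 1 < c)
    (z : laurent F) (hz : z != 0)
    (N : option nat) (n : nat -> int) (f : nat -> {poly F})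
    (hcf : schneider_cf P d z N n f)
    (r : nat) (hr : leN r.+1 N) :
  exists p q : ratfun F,
    [/\ inA_P P p /\ inA_P P q,
        q != 0 /\ convergent P n f r = p / q,
        nu (z - toL (p / q)) =
          (- (2 * nu (toL q)) + deg (f r.+1)
           - (\sum_(1 <= i < r.+2) n i * d%:Z)%R%:E)%E
      & absv c (z - toL (p / q)) =
          absv c (toL P%:F ^ (\sum_(1 <= i < r.+2) n i))
          / (absv c (toL (f r.+1)%:F) * absv c (toL q) ^+ 2)].
Proof.
have [zs [<- zsP _]] := hcf.
have [p [q [pqA q0 eC [a [b [ea eb]]]]]] := cfrac_approx hP zsP 1 r isT hr.
rewrite eC => nuE; exists p, q; split=> //.
  by rewrite nuE ea eb !EFinD !EFinN EFinM.
have nuf : nu (toL (f r.+1)%:F) = (- b)%:E by rewrite nu_toL_poly eb EFinN.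
have c0 : c != 0 by rewrite gt_eqF // (lt_trans ltr01).
rewrite (absv_fin _ _ _ _ _ nuE) (absv_fin _ _ _ _ _ ea).
rewrite (absv_fin _ _ _ _ _ nuf) (absv_fin _ _ _ _ _ (nu_PXz hP _)).
(* Both sides are integer powers of [c]; once these are merged, only an identity between exponents
   is left. *)
rewrite exprnP exprz_exp -expfzDr // invr_expz -expfzDr // mulr_suml.
by congr (_ ^ _); ring.
Qed.
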